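(* Let $n\ge3$ and let $\mathcal M=(G,\mathit{In},\mathit{Out},\mathit{Leak})$ be an $n$-compartment directed-cycle model with $\mathit{In}=\{1\}$ that is generically locally identifiable (equivalently, leak-interlacing). Let $\mathcal S_{\mathcal M}$ denote its singular locus. Write $k_{n+1,n}:=k_{1n}$. (1) If there exists a leak $\ell\in\mathit{Leak}\setminus\{1\}$, then $\mathcal S_{\mathcal M}$ contains the hyperplane $\{k_{21}=0\}$. (2) If $\mathit{Leak}=\{\ell_1,\dots,\ell_z\}$ with $1\le\ell_1<\dots<\ell_z\le n$ and $z\ge1$, and $\ell_z\ge p$ for all $p\in\mathit{Out}$, then $\mathcal S_{\mathcal M}$ contains the hyperplane $\{k_{a+1,a}=0\}$ for every $a\in\{1,\dots,n\}\setminus\{\ell_z\}$. (3) If $\mathit{Out}=\{p\}$ and $\mathit{Leak}=\{q,p\}$ with $1\le q<p\le n-1$, then $\mathcal S_{\mathcal M}$ contains the hyperplane $\{k_{0q}+k_{q+1,q}=k_{0p}+k_{p+1,p}\}$.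
   Context: A linear compartmental model $\mathcal M=(G,\mathit{In},\mathit{Out},\mathit{Leak})$ consists of a finite directed graph $G=(V,E)$ with $V=\{1,\dots,n\}$ and subsets $\mathit{In},\mathit{Out},\mathit{Leak}\subseteq V$; always $|\mathit{In}|\ge1$, $|\mathit{Out}|\ge1$. Each edge $j\to i$ carries a parameter $k_{ij}$, each $\ell\in\mathit{Leak}$ a parameter $k_{0\ell}$; parameter space $\mathbb R^{|E|+|\mathit{Leak}|}$. The compartmental matrix $A$ has $a_{ii}=-\sum_{p:\,i\to p\in E}k_{pi}$ (additionally $-k_{0i}$ if $i\in\mathit{Leak}$), $a_{ij}=k_{ij}$ if $j\to i\in E$, $0$ otherwise ($i\ne j$). For $i\in\mathit{Out}$ the input-output equation is $\det(\partial I-A)\,y_i=\sum_{j\in\mathit{In}}(-1)^{i+j}\det[(\partial I-A)^{j,i}]\,u_j$ ($\partial=d/dt$; $B^{j,i}$ deletes row $j$ and column $i$); its coefficients are polynomials in the parameters, and the coefficient map $\mathsf c$ is the vector of these coefficients over all outputs (containing all non-constant ones). The model is generically locally identifiable if, outside a measure-zero set, every parameter vector has a neighborhood on which $\mathsf c$ is injective; for strongly connected models this is equivalent to the Jacobian of $\mathsf c$ having rank $|E|+|\mathit{Leak}|$ at a generic point. For an identifiable model, the singular locus is the set of parameter vectors in $\mathbb R^{|E|+|\mathit{Leak}|}$ at which the Jacobian matrix of $\mathsf c$ does not have full rank $|E|+|\mathit{Leak}|$. A directed-cycle model has $n\ge3$, $V=\{1,\dots,n\}$, $E=\{1\to2,\dots,(n-1)\to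 n,n\to1\}$; indices mod $n$. It is exceptional if for some $i$: $\mathit{In}=\{i\}$, $\mathit{Out}=\{i-1\}$, $|\mathit{Leak}|=2$, $i-1\in\mathit{Leak}$. It is leak-interlacing if it is not exceptional and either $|\mathit{Leak}|\le1$, or $|\mathit{Leak}|\ge2$ with $\mathit{Leak}=\{\ell_1<\dots<\ell_z\}$ and for every $\alpha$, $\{\ell_\alpha+1,\dots,\ell_{\alpha+1}\}\cap(\mathit{In}\cup\mathit{Out})\ne\emptyset$ ($\ell_{z+1}:=\ell_1$, taken cyclically mod $n$). *)

(* Defs.v *)
From HB Require Import structures.
From mathcomp Require Import all_boot all_order all_algebra.
From mathcomp Require Import all_classical all_reals all_analysis.

Set Implicit Arguments.
Unset Strict Implicit.
Unset Printing Implicit Defensive.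

Import Order.TTheory GRing.Theory Num.Theory.
Import numFieldNormedType.Exports.

Local Open Scope ring_scope.
Local Open Scope classical_set_scope.

(* The compartment called i in the mathematical text, 1 <= i <= n, is the      *)
(* ordinal of value i - 1.                                                    *)
Definition label (n : nat) (i : 'I_n) : nat := i.+1.

(* (j, i) \in edges stands for the edge j -> i.                               *)
Record lcmodel (n : nat) := LCModel {
  edges : {set 'I_n * 'I_n};
  inputs : {set 'I_n};
  outputs : {set 'I_n};
  leaks : {set 'I_n};
  inputs_neq0 : (0 < #|inputs|)%N;
  outputs_neq0 : (0 < #|outputs|)%N }.

Definition nparams (n : nat) (M : lcmodel n) : nat :=
  (#|edges M| + #|leaks M|)%N.

Section Model.
Variables (R : realType) (n : nat) (M : lcmodel n).

(* The first #|edges M| coordinates of a parameter vector are the edge        *)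
(* parameters, the remaining #|leaks M| ones are the leak parameters, each    *)
(* family being listed in the order of enum.                                  *)
Implicit Types theta : 'rV[R]_(nparams M).

(* k_{ij}: the sum has exactly one term if j -> i is an edge, none otherwise  *)
(* (so that k_{ij} is then 0); same remark for k_{0l}.                        *)
Definition kedge theta (i j : 'I_n) : R :=
  \sum_(e < #|edges M| | enum_val e == (j, i)) theta 0 (lshift #|leaks M| e).

Definition kleak theta (l : 'I_n) : R :=
  \sum_(e < #|leaks M| | enum_val e == l) theta 0 (rshift #|edges M| e).

Definition compartmental_mx theta : 'M[R]_n :=
  \matrix_(i, j)
    if i == j then
      - (\sum_(p | (i, p) \in edges M) kedge theta p i)
      - (if i \in leaks M then kleak theta i else 0)
    else if (j, i) \in edges M then kedge theta i j else 0.

(* The differential operators occurring in the input-output equation of       *)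
(* output i, as polynomials in d/dt: the one applied to y_i (None), and the   *)
(* one applied to u_j (Some j). Note that                                     *)
(* cofactor B j i = (-1) ^+ (j + i) * \det (row' j (col' i B)).               *)
Definition io_operator theta (i : 'I_n) (o : option 'I_n) : {poly R} :=
  if o is Some j then cofactor (char_poly_mx (compartmental_mx theta)) j i
  else \det (char_poly_mx (compartmental_mx theta)).

(* (i, o, d): coefficient of order d of io_operator _ i o. These operators    *)
(* have order at most n, hence the list is complete; it also contains         *)
(* constant coefficients.                                                     *)
Definition coef_index : {set 'I_n * option 'I_n * 'I_n.+1} :=
  [set x | (x.1.1 \in outputs M) &&
           (if x.1.2 is Some j then j \in inputs M else true)]%SET.

Definition coef_map theta : 'rV[R]_#|coef_index| :=
  \row_(x < #|coef_index|) (let: (i, o, d) := enum_val x in (io_operator theta i o)`_d).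

End Model.

(* Lebesgue-null subsets of R^m, by countable covers with boxes of arbitrarily *)
(* small total volume.                                                        *)
Definition null_set (R : realType) (m : nat) (Z : set 'rV[R]_m) : Prop :=
  forall eps : R, 0 < eps ->
  exists a b : nat -> 'rV[R]_m,
    [/\ forall k i, a k 0 i <= b k 0 i,
        Z `<=` \bigcup_k [set x | forall i, a k 0 i <= x 0 i <= b k 0 i] &
        (\sum_(0 <= k <oo) (\prod_(i < m) (b k 0 i - a k 0 i))%:E <= eps%:E)%E].

Definition generically_locally_identifiable
    (R : realType) (n : nat) (M : lcmodel n) : Prop :=
  exists2 Z : set 'rV[R]_(nparams M), null_set Z &
    forall theta, ~ Z theta ->
      exists2 U, nbhs theta U & set_inj U (@coef_map R n M).

Definition singular_locus (R : realType) (n : nat) (M : lcmodel n) :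
    set 'rV[R]_(nparams M) :=
  [set theta | \rank (jacobian (@coef_map R n M) theta) <> nparams M].

(* ordS is the successor modulo n.                                            *)
Definition directed_cycle (n : nat) (M : lcmodel n) : Prop :=
  (3 <= n)%N /\ edges M = [set (i, ordS i) | i : 'I_n]%SET.

(* Main.v *)
(* Writing k_i for k_{i+1,i} and d_i for k_i plus the leak rate of i, the
   operators of a directed cycle with input 1 are
     prod_i (X + d_i) - prod_i k_i   and
     (prod_(i < p) k_i) * prod_(i > p) (X + d_i)   for each output p.
   At every point of the hyperplanes in question there is a nonzero direction v
   with c (theta + t v) = c theta + t^2 w for all t, so that v is in the kernel
   of the differential. In (1) and (2), v moves k_l and k_{0l} by t and - t for
   a leak l: the d_i are constant, and each product of the k_i either contains
   the vanishing parameter or does not contain k_l. In (3), v moves k_{0q} and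
   k_{0p} by t and - t. *)
Require Import Defs.
From HB Require Import structures.
From mathcomp Require Import all_boot all_order all_fingroup all_algebra.
From mathcomp Require Import all_classical all_reals all_analysis.
From mathcomp Require Import zify ring.

Set Implicit Arguments.
Unset Strict Implicit.
Unset Printing Implicit Defensive.

Import Order.TTheory GRing.Theory Num.Theory.
Import numFieldNormedType.Exports.

Local Open Scope ring_scope.
Local Open Scope classical_set_scope.

(** * Determinants of triangular and bidiagonal matrices *)

(* Only s = 1 contributes to the Leibniz formula: r (s i) <= r i for all i and
   sum_i r (s i) = sum_i r i force r \o s = r. *)
Lemma det_rank_trig (S : comPzRingType) (n : nat) (C : 'M[S]_n)
    (r : 'I_n -> nat) :
  injective r -> (forall i j, (r i < r j)%N -> C i j = 0) ->
  \det C = \prod_i C i i.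
Proof.
move=> r_inj C0; rewrite /determinant (bigD1 (1%g : {perm _})) //=.
rewrite odd_perm1 expr0 mul1r.
rewrite [X in _ + X]big1 ?addr0; first by apply: eq_bigr => i _; rewrite perm1.
move=> s s1; have [i lt_i] : exists i, (r i < r (s i))%N.
  apply/existsP; apply: contraNT s1; rewrite negb_exists => /forallP ge_r.
  have le_r j : (r (s j) <= r j)%N by rewrite leqNgt ge_r.
  have := (leqif_sum (fun (j : 'I_n) (_ : true) => leqif_eq (le_r j))).2.
  rewrite -(reindex_inj (@perm_inj _ s) (P := xpredT) (F := r)) eqxx.
  move=> /esym/forallP eq_r; apply/eqP/permP => i; rewrite perm1.
  by apply: r_inj; apply/eqP; have := eq_r i.
by rewrite (bigD1 i) //= C0 // mul0r mulr0.
Qed.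

(** The edge from the last compartment to the first has its entry in row 0, which the cofactor
    deletes. The remaining minor has the entries [B (ordS i) i] for i < p, then [B i i] for i > p,
    on its diagonal. *)
Lemma cofactor_bidiag (S : comPzRingType) (n : nat) (B : 'M[S]_n.+1)
    (p : 'I_n.+1) :
  (forall i j : 'I_n.+1, (0 < i)%N -> j != i -> j.+1 != i -> B i j = 0) ->
  cofactor B ord0 p =
  (\prod_(i < n.+1 | (i < p)%N) - B (ordS i) i) *
  \prod_(i < n.+1 | (p < i)%N) B i i.
Proof.
move=> B0; have le_pn : (p <= n)%N by rewrite -ltnS.
(* Deleting row 0 and column p leaves an upper triangular block of size p and
   a lower triangular one. *)
pose r (i : 'I_n) := if (i < p)%N then (p - i.+1)%N else i : nat.
rewrite /cofactor (det_rank_trig (r := r)); first last.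
- move=> i j; rewrite /r !mxE.
  case: (ltnP i p) => ip; case: (ltnP j p) => jp lt_r; apply: B0 => //;
    rewrite -?val_eqE /= /bump ?(leqNgt p j) ?jp /=; lia.
- move=> i j; rewrite /r => e; apply: val_inj => /=; move: e.
  by case: (ltnP i p) => ip; case: (ltnP j p) => jp; lia.
rewrite add0n (bigID (fun i : 'I_n => (i < p)%N)) /= mulrA; congr (_ * _).
  (* The sign of the cofactor supplies one minus sign for each of the p subdiagonal factors. *)
  have -> : (-1 : S) ^+ p = \prod_(i < n | (i < p)%N) -1.
    by rewrite -(big_ord_widen n (fun=> -1)) // prodr_const card_ord.
  rewrite -big_split /=.
  rewrite [in RHS]big_mkcond big_ord_recr /= ltnNge le_pn mulr1 big_mkcond /=.
  apply: eq_bigr => i _; case: ifP => // lt_ip; rewrite !mxE mulN1r.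
  congr (- B _ _); apply: val_inj => /=.
    by rewrite modn_small // ltnS ltn_ord.
  by rewrite /bump leqNgt lt_ip.
rewrite [in RHS]big_mkcond big_ord_recl /= mul1r big_mkcond /=.
apply: eq_bigr => i _; rewrite -leqNgt /= /bump add1n ltnS.
case: ifP => // le_pi; rewrite !mxE; congr (B _ _); apply: val_inj => //=.
by rewrite /bump le_pi.
Qed.

Lemma ordS_eq0 (n : nat) (j : 'I_n.+1) : (ord0 == ordS j) = (j == ord_max).
Proof.
rewrite -!val_eqE /=; have := ltn_ord j; rewrite ltnS leq_eqVlt.
case/orP => [/eqP -> | lt_jn]; first by rewrite modnn !eqxx.
by rewrite modn_small; lia.
Qed.

(** * Differentiability of coefficients and directional derivatives *)

Section Differentiability.
Variables (R : realType) (V : normedModType R) (x : V).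

Lemma differentiable_bigsum (I : Type) (s : seq I) (P : pred I)
    (F : I -> V -> R) :
  (forall i, differentiable (F i) x) ->
  differentiable (fun y => \sum_(i <- s | P i) F i y) x.
Proof.
move=> dF; rewrite (_ : (fun y => _) = \sum_(i <- s | P i) F i); last first.
  by apply/funext => y; rewrite fct_sumE.
elim/big_ind: _ => //.
by move=> f g df dg; apply: differentiableD.
Qed.

(** Stated coefficient by coefficient, so that no norm on polynomials is involved. *)
Definition coef_differentiable (P : V -> {poly R}) : Prop :=
  forall d, differentiable (fun y => (P y)`_d) x.

Lemma coef_differentiable_cst (P : {poly R}) :
  coef_differentiable (fun _ => P).
Proof. by move=> d; apply: differentiable_cst. Qed.

Lemma coef_differentiableD (P Q : V -> {poly R}) :
  coef_differentiable P -> coef_differentiable Q ->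
  coef_differentiable (fun y => P y + Q y).
Proof.
move=> dP dQ d; under eq_fun do rewrite coefD.
exact: (differentiableD (dP d) (dQ d)).
Qed.

Lemma coef_differentiableM (P Q : V -> {poly R}) :
  coef_differentiable P -> coef_differentiable Q ->
  coef_differentiable (fun y => P y * Q y).
Proof.
move=> dP dQ d; under eq_fun do rewrite coefM.
apply: differentiable_bigsum => j; exact: (differentiableM (dP j) (dQ _)).
Qed.

Lemma coef_differentiable_det (n : nat) (B : V -> 'M[{poly R}]_n) :
  (forall i j, coef_differentiable (fun y => B y i j)) ->
  coef_differentiable (fun y => \det (B y)).
Proof.
move=> dB; rewrite /determinant.
elim: (index_enum _) => [|s l IHl].
  under eq_fun do rewrite big_nil; exact: coef_differentiable_cst.
under eq_fun do rewrite big_cons.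
apply: coef_differentiableD => //.
apply: coef_differentiableM; first exact: coef_differentiable_cst.
elim: (index_enum _) => [|i l' IHl'].
  under eq_fun do rewrite big_nil; exact: coef_differentiable_cst.
by under eq_fun do rewrite big_cons; apply: coef_differentiableM.
Qed.

End Differentiability.

(** The difference quotient at h is [h *: w], which tends to 0. *)
Lemma derive_quadratic (R : realType) (V W : normedModType R) (f : V -> W)
    (x v : V) (w : W) :
  (forall t : R, f (x + t *: v) = f x + t ^+ 2 *: w) -> 'D_v f x = 0.
Proof.
move=> fE; rewrite /derive; apply/cvg_lim => //.
have -> : 0 = (0 : R) *: w by rewrite scale0r.
apply: (@cvg_trans _ ((fun h : R => h *: w) @ 0^')).
  apply: near_eq_cvg; near=> h.
  rewrite /= [_ *: v + x]addrC fE addrAC subrr add0r scalerA expr2.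
  rewrite mulrA mulVf ?mul1r //.
  by near: h; apply: nbhs_dnbhs_neq.
apply: cvg_within_filter; exact: scalel_continuous.
Unshelve. all: by end_near. Qed.

(** * A criterion for singular points *)

Section Singular.
Variables (R : realType) (n : nat) (M : lcmodel n).
Implicit Types theta v : 'rV[R]_(nparams M).

(** Differentiability identifies the Jacobian applied to a direction with the directional
    derivative. *)
Lemma differentiable_coef_map theta :
  differentiable (@Defs.coef_map R n M) theta.
Proof.
have dk i j : differentiable (fun y => @kedge R n M y i j) theta.
  by apply: differentiable_bigsum => e; apply: differentiable_coord.
have dl i : differentiable (fun y => @kleak R n M y i) theta.
  by apply: differentiable_bigsum => e; apply: differentiable_coord.
have dB i j : coef_differentiable theta
    (fun y => char_poly_mx (compartmental_mx y) i j).
  under eq_fun do rewrite !mxE.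
  apply: coef_differentiableD; first exact: coef_differentiable_cst.
  (* The parameters enter only the constant coefficient of an entry. *)
  move=> d; under eq_fun do rewrite coefN coefC.
  apply: differentiableN.
  case: (d == 0%N); last exact: differentiable_cst.
  case: (i == j); last first.
    by case: (_ \in edges M) => //; apply: differentiable_cst.
  apply: differentiableD.
    by apply: differentiableN; apply: differentiable_bigsum.
  apply: differentiableN.
  by case: (i \in leaks M) => //; apply: differentiable_cst.
(* Splitting along the standard basis reduces the claim to single coordinates. *)
rewrite (_ : @Defs.coef_map R n M = \sum_(x < #|coef_index M|) (fun y =>
    (Defs.coef_map y) 0 x *: delta_mx 0 x)); last first.
  by apply/funext => y; rewrite fct_sumE; apply: row_sum_delta.
apply: differentiable_sum => x; apply: differentiableZl.
under eq_fun do rewrite mxE.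
case: (enum_val x) => [[i [j|]] d] /=; last exact: coef_differentiable_det.
apply: (@coef_differentiableM _ _ _ (fun=> _)).
  exact: coef_differentiable_cst.
apply: coef_differentiable_det => k l; under eq_fun do rewrite 2!mxE.
by apply: dB.
Qed.

(** Along v the coefficients have no linear term in t, so v is a nonzero kernel vector of the
    differential, which excludes full rank. *)
Lemma singular_of_quadratic theta v (Q : 'I_n -> option 'I_n -> {poly R}) :
  v != 0 ->
  (forall t i o, i \in outputs M ->
     (if o is Some j then j \in inputs M else true) ->
     io_operator (theta + t *: v) i o =
     io_operator theta i o + t ^+ 2 *: Q i o) ->
  singular_locus theta.
Proof.
move=> v0 ioE full.
(* The Jacobian multiplies row vectors from the right, so full rank means that its rows, one per
   parameter, are independent. *)
have free : row_free (jacobian (@Defs.coef_map R n M) theta) by apply/eqP.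
move/eqP: v0; apply; apply: (row_free_inj free); rewrite mul0mx.
rewrite -deriveEjacobian; last exact: differentiable_coef_map.
pose w : 'rV[R]_#|coef_index M| :=
  \row_(x < #|coef_index M|) (let: (i, o, d) := enum_val x in (Q i o)`_d).
apply: (@derive_quadratic _ _ _ _ _ _ w) => t.
apply/rowP => x; rewrite !mxE.
have := enum_valP x; rewrite inE.
case: (enum_val x) => [[i o] d] /= /andP[oi io].
by rewrite ioE // coefD coefZ.
Qed.

End Singular.

(** * Operators and parameter directions of a directed cycle *)

Section Cycle.
Variables (R : realType) (n : nat) (M : lcmodel n.+1).
Hypothesis cycleM : directed_cycle M.
Implicit Types theta : 'rV[R]_(nparams M).

Definition kout theta (i : 'I_n.+1) : R := kedge theta (ordS i) i.

(** The rate d_i, which is minus the i-th diagonal entry of the compartmental matrix. *)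
Definition decay theta (i : 'I_n.+1) : R :=
  kout theta i + (if i \in leaks M then kleak theta i else 0).

Lemma cycle_edge (i j : 'I_n.+1) : ((i, j) \in edges M) = (j == ordS i).
Proof.
rewrite cycleM.2; apply/imsetP/eqP => [[k _ [-> ->]] //| ->].
by exists i.
Qed.

Lemma char_poly_mx_cycle theta (i j : 'I_n.+1) :
  char_poly_mx (compartmental_mx theta) i j =
  if i == j then 'X + (decay theta i)%:P
  else if i == ordS j then - (kout theta j)%:P else 0.
Proof.
rewrite !mxE; case: eqVneq => [_ | _].
  rewrite mulr1n (eq_bigl (pred1 (ordS i))); last first.
    by move=> p; rewrite cycle_edge.
  by rewrite big_pred1_eq -opprD polyCN opprK.
by rewrite mulr0n sub0r cycle_edge; case: eqP => [-> //|_]; rewrite oppr0.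
Qed.

Let n_gt0 : (0 < n)%N. Proof. by have := cycleM.1; lia. Qed.

Lemma ordS_neq (i : 'I_n.+1) : ordS i != i.
Proof.
rewrite -val_eqE /=; have := ltn_ord i; rewrite ltnS leq_eqVlt.
case/orP => [/eqP -> | lt_in]; first by rewrite modnn; lia.
by rewrite modn_small; lia.
Qed.

(** This is the operator applied to u_1 in the equation of output p. Away from row 0 the matrix is
    bidiagonal, and its entries -k_i absorb the signs of [cofactor_bidiag]. *)
Lemma cofactor_cycle theta (p : 'I_n.+1) :
  cofactor (char_poly_mx (compartmental_mx theta)) ord0 p =
  (\prod_(i < n.+1 | (i < p)%N) kout theta i)%:P *
  \prod_(i < n.+1 | (p < i)%N) ('X + (decay theta i)%:P).
Proof.
rewrite cofactor_bidiag; last first.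
  move=> i j i_gt0 ji ji1; rewrite char_poly_mx_cycle eq_sym (negPf ji).
  rewrite -val_eqE /= ; case: eqP => // e; move: ji1 i_gt0; rewrite e.
  (* For the last j the successor wraps to 0, against [i_gt0]; otherwise it is j + 1, against
     [ji1]. *)
  have := ltn_ord j; rewrite ltnS leq_eqVlt.
  case/orP => [/eqP -> | lt_jn]; first by rewrite modnn.
  by rewrite modn_small ?eqxx.
rewrite rmorph_prod /=; congr (_ * _); apply: eq_bigr => i _.
  by rewrite char_poly_mx_cycle (negPf (ordS_neq i)) eqxx opprK.
by rewrite char_poly_mx_cycle eqxx.
Qed.

(** Row 0 is supported on its first and last columns. Their cofactors are the extreme cases of
    [cofactor_cycle], where one of the two products is empty. *)
Lemma char_poly_cycle theta :
  \det (char_poly_mx (compartmental_mx theta)) =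
  \prod_i ('X + (decay theta i)%:P) - (\prod_i kout theta i)%:P.
Proof.
rewrite (expand_det_row _ ord0) (bigD1 ord0) //= (bigD1 ord_max) /=; last first.
  by rewrite -val_eqE /= -lt0n.
rewrite [X in _ + (_ + X)]big1 ?addr0; last first.
  move=> i /andP[i0 im]; rewrite char_poly_mx_cycle eq_sym (negPf i0).
  by rewrite ordS_eq0 (negPf im) mul0r.
rewrite !cofactor_cycle !char_poly_mx_cycle eqxx ordS_eq0 eqxx.
rewrite -val_eqE /= eq_sym eqn0Ngt n_gt0 /=; congr (_ + _).
  rewrite big_pred0 // mul1r [in RHS](bigD1 ord0) //=; congr (_ * _).
  by apply: eq_bigl => i; rewrite lt0n -val_eqE.
rewrite [X in _ * (_ * X)]big_pred0; last by move=> i; have := ltn_ord i; lia.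
rewrite mulr1 mulNr -polyCM [in RHS](bigD1 ord_max) //=.
congr (- (_ * _)%:P); apply: eq_bigl => i.
by rewrite -val_eqE /=; have := ltn_ord i; lia.
Qed.

(** Laid out like a parameter vector; an edge of the cycle is determined by its source, hence the
    [.1]. *)
Definition direction (dk dl : 'I_n.+1 -> R) : 'rV[R]_(nparams M) :=
  row_mx (\row_(e < #|edges M|) dk (enum_val e).1)
         (\row_(e < #|leaks M|) dl (enum_val e)).

(** Turns the one-term sums defining [kedge] and [kleak] into single coordinates. *)
Lemma enum_val_pred1 (T : finType) (A : {set T}) (x : T) (F : 'I_#|A| -> R)
    (xA : x \in A) :
  \sum_(e < #|A| | enum_val e == x) F e = F (enum_rank_in xA x).
Proof.
rewrite (big_pred1 (enum_rank_in xA x)) // => e /=.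
by rewrite -(inj_eq enum_val_inj) enum_rankK_in.
Qed.

Lemma kout_direction theta dk dl t i :
  kout (theta + t *: direction dk dl) i = kout theta i + t * dk i.
Proof.
have e_i : (i, ordS i) \in edges M by rewrite cycle_edge.
rewrite /kout /kedge !(enum_val_pred1 _ e_i) mxE; congr (_ + _).
by rewrite mxE row_mxEl mxE enum_rankK_in.
Qed.

Lemma kleak_direction theta dk dl t i : i \in leaks M ->
  kleak (theta + t *: direction dk dl) i = kleak theta i + t * dl i.
Proof.
move=> l_i; rewrite /kleak !(enum_val_pred1 _ l_i) mxE; congr (_ + _).
by rewrite mxE row_mxEr mxE enum_rankK_in.
Qed.

Lemma decay_direction theta dk dl t i :
  decay (theta + t *: direction dk dl) i =
  decay theta i + t * (dk i + if i \in leaks M then dl i else 0).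
Proof.
rewrite /decay kout_direction; case: ifP => [li|_]; last by rewrite !addr0.
by rewrite kleak_direction //; ring.
Qed.

Lemma direction_neq0 dk dl i : i \in leaks M -> dl i != 0 ->
  direction dk dl != 0.
Proof.
move=> li; apply: contra_neq => v0.
(* Base point 0 and t = 1 recover [dl i] from the direction itself. *)
have := kleak_direction 0 dk dl 1 li.
by rewrite v0 scaler0 addr0 mul1r -[LHS]addr0 => /addrI.
Qed.

(** * Singular points when compartment 1 is the only input *)

Hypothesis inM : inputs M = [set ord0]%SET.

Lemma cycle_input_cases (o : option 'I_n.+1) :
  (if o is Some j then j \in inputs M else true) ->
  o = None \/ o = Some ord0.
Proof.
by case: o => [j|]; [rewrite inM inE => /eqP ->; right | left].
Qed.

(* Trading the outflow of l for its leak keeps every decay rate, and it does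
   not affect the products of the k's that contain k_a = 0. *)
Lemma singular_exchange theta (l a : 'I_n.+1) :
  l \in leaks M -> a != l -> kout theta a = 0 ->
  (forall p : 'I_n.+1, p \in outputs M -> (l < p)%N -> (a < p)%N) ->
  singular_locus theta.
Proof.
move=> leak_l a_l ka0 lt_a; pose e i : R := (i == l)%:R.
pose v := direction e (fun i => - e i).
have decayE t i : decay (theta + t *: v) i = decay theta i.
  rewrite decay_direction /e; case: (eqVneq i l) => [->|_].
    by rewrite leak_l subrr mulr0 addr0.
  by rewrite oppr0 if_same addr0 mulr0 addr0.
(* If l occurs in the product, so does a, and both sides vanish; otherwise no factor moves. *)
have koutE t (P : pred 'I_n.+1) : (P l -> P a) ->
    \prod_(i | P i) kout (theta + t *: v) i = \prod_(i | P i) kout theta i.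
  move=> Pla; case Pl: (P l).
    rewrite (bigD1 a) ?[RHS](bigD1 a) /= ?Pla // kout_direction /e.
    by rewrite (negPf a_l) mulr0 addr0 ka0 !mul0r.
  apply: eq_bigr => i Pi; rewrite kout_direction /e.
  by case: eqVneq Pi => [-> | _]; rewrite ?Pl // mulr0 addr0.
(* All coefficients are constant along v, so the quadratic term is 0. *)
apply: (@singular_of_quadratic _ _ _ _ v (fun _ _ => 0)).
  by apply: (direction_neq0 _ leak_l); rewrite /e eqxx oppr_eq0 oner_eq0.
move=> t p o out_p /cycle_input_cases[] ->; rewrite scaler0 addr0 /=.
  rewrite !char_poly_cycle koutE //; congr (_ - _).
  by apply: eq_bigr => i _; rewrite decayE.
rewrite !cofactor_cycle koutE; last exact: lt_a.
by congr (_ * _); apply: eq_bigr => i _; rewrite decayE.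
Qed.

(* Raising one of two equal decay rates by t and lowering the other one by t
   changes (X + d_q) (X + d_p) by - t^2 only. *)
Lemma singular_equal_decay theta (q p : 'I_n.+1) :
  outputs M = [set p]%SET -> q \in leaks M -> p \in leaks M -> (q < p)%N ->
  decay theta q = decay theta p -> singular_locus theta.
Proof.
move=> outM leak_q leak_p lt_qp eq_d.
have q_p : q != p by rewrite -val_eqE /=; lia.
pose dl i : R := (i == q)%:R - (i == p)%:R.
pose v := direction (fun=> 0) dl.
have koutE t i : kout (theta + t *: v) i = kout theta i.
  by rewrite kout_direction mulr0 addr0.
have decayE t i : i != q -> i != p -> decay (theta + t *: v) i = decay theta i.
  move=> iq ip; rewrite decay_direction /dl (negPf iq) (negPf ip) subrr if_same.
  by rewrite addr0 mulr0 addr0.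
have decayq t : decay (theta + t *: v) q = decay theta p + t.
  by rewrite decay_direction /dl leak_q eqxx (negPf q_p) subr0 add0r mulr1 eq_d.
have decayp t : decay (theta + t *: v) p = decay theta p - t.
  rewrite decay_direction /dl leak_p eqxx eq_sym (negPf q_p).
  by rewrite sub0r add0r mulrN1.
(* Only the operator on y changes, by -t^2 times the product of the unmoved factors. *)
pose Q (_ : 'I_n.+1) (o : option 'I_n.+1) : {poly R} :=
  if o is None then
    - \prod_(i | (i != q) && (i != p)) ('X + (decay theta i)%:P) else 0.
apply: (@singular_of_quadratic _ _ _ _ v Q).
  apply: (direction_neq0 _ leak_q).
  by rewrite /dl eqxx (negPf q_p) subr0 oner_eq0.
move=> t i o; rewrite outM inE => /eqP -> {i} /cycle_input_cases[] -> /=.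
  rewrite !char_poly_cycle (eq_bigr _ (fun i _ => koutE t i)).
  rewrite [RHS]addrAC; congr (_ - _).
  have prodE (F : 'I_n.+1 -> {poly R}) :
      \prod_i F i = F q * (F p * \prod_(i | (i != q) && (i != p)) F i).
    by rewrite (bigD1 q) // (bigD1 p) // eq_sym.
  rewrite [in LHS]prodE [in RHS]prodE decayq decayp eq_d.
  under [in LHS]eq_bigr => i /andP[iq ip] do rewrite decayE //.
  set W := \prod_(i | _) _; rewrite -mul_polyC.
  have -> : (t ^+ 2)%:P = t%:P * t%:P :> {poly R} by rewrite expr2 polyCM.
  rewrite polyCB polyCD; ring.
(* The operator on u_1 involves only decay rates of index above p, and q < p keeps both moved rates
   out of it. *)
rewrite scaler0 addr0 !cofactor_cycle (eq_bigr _ (fun i _ => koutE t i)).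
congr (_ * _); apply: eq_bigr => i lt_pi.
by rewrite decayE // -val_eqE /=; lia.
Qed.

End Cycle.

(** * The three kinds of hyperplanes *)

Theorem theorem4p3 (R : realType) (n : nat) (M : lcmodel n)
    (n_ge3 : (3 <= n)%N)
    (cycleM : directed_cycle M)
    (inM : inputs M = [set i | label i == 1%N]%SET)
    (identM : generically_locally_identifiable R M) :
  [/\ (forall l : 'I_n, l \in leaks M -> label l <> 1%N ->
        forall a : 'I_n, label a = 1%N ->
        [set theta | kedge theta (ordS a) a = 0] `<=` @singular_locus R n M),
      (forall lz : 'I_n, lz \in leaks M ->
        (forall l, l \in leaks M -> (label l <= label lz)%N) ->
        (forall p, p \in outputs M -> (label p <= label lz)%N) ->
        forall a : 'I_n, a <> lz ->
        [set theta | kedge theta (ordS a) a = 0] `<=` @singular_locus R n M) &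
      (forall q p : 'I_n, outputs M = [set p]%SET ->
        leaks M = [set q; p]%SET ->
        (label q < label p <= n - 1)%N ->
        [set theta | kleak theta q + kedge theta (ordS q) q =
                     kleak theta p + kedge theta (ordS p) p]
          `<=` @singular_locus R n M)].
Proof.
case: n M n_ge3 cycleM inM identM => // n M _ cycleM inM _.
have {}inM : inputs M = [set ord0]%SET.
  by rewrite inM; apply/setP => i; rewrite !inE /label eqSS -val_eqE.
split=> [l leak_l l1 a a1 theta ka0 | l leak_l _ out_l a a_l theta ka0
       | q p outM leakM /andP[lt_qp _] theta eq_d].
- apply: (singular_exchange cycleM inM leak_l _ ka0).
    by apply/eqP => al; apply: l1; rewrite -al.
  (* Since a has value 0, l < p gives a < p. *)
  by case: a1 => -> p _; apply: leq_ltn_trans.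
- apply: (singular_exchange cycleM inM leak_l _ ka0); first exact/eqP.
  (* No output lies beyond the leak l, so the condition on a is vacuous. *)
  by move=> p /out_l; rewrite /label ltnS leqNgt => /negPf ->.
- have leak_q : q \in leaks M by rewrite leakM !inE eqxx.
  have leak_p : p \in leaks M by rewrite leakM !inE eqxx orbT.
  apply: (singular_equal_decay cycleM inM outM leak_q leak_p) => //.
  by rewrite /decay leak_q leak_p ![kout _ _ + _]addrC.
Qed.
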